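(* Let $Q$ be a quiver with finite vertex set $Q_0$, let $\mathscr{R}=(\{\mathscr{C}_x\}_{x\in Q_0\cup Q_1},\{S_a,T_a\}_{a\in Q_1})$ be a categorical realization of $Q$, and let $\rho=(\{C_v\}_{v\in Q_0},\{f_a\}_{a\in Q_1})\in\mathrm{Rep}(Q,\mathscr{R})$. Assume that $\mathrm{End}_{\mathscr{C}_v}(C_v)$ is semilocal for all $v\in Q_0$. Then $\rho$ cancels from direct sums in $\mathrm{Rep}(Q,\mathscr{R})$.
   Context: A quiver $Q$ is a directed graph (loops and multiple edges allowed) with vertex set $Q_0$, always assumed finite, and edge set $Q_1$, possibly infinite; $s(a)$, $t(a)$ are the source and target of an edge $a$. A categorical realization $\mathscr{R}=(\{\mathscr{C}_x\}_{x\in Q_0\cup Q_1},\{S_a,T_a\}_{a\in Q_1})$ of $Q$ consists of an additive category $\mathscr{C}_v$ for each $v\in Q_0$, and, for each $a\in Q_1$, an additive category $\mathscr{C}_a$ and additive functors $S_a:\mathscr{C}_{s(a)}\to\mathscr{C}_a$, $T_a:\mathscr{C}_{t(a)}\to\mathscr{C}_a$. A representation of $Q$ on $\mathscr{R}$ is a pair $(\{C_v\}_{v\in Q_0},\{f_a\}_{a\in Q_1})$ with $C_v\in\mathscr{C}_v$ and $f_a\in\mathrm{Hom}_{\mathscr{C}_a}(S_aC_{s(a)},T_aC_{t(a)})$. A morphism $(\{C_v\},\{f_a\})\to(\{C'_v\},\{f'_a\})$ is a family $\{\psi_v\}_{v\in Q_0}$ with $\psi_v\in\mathrm{Hom}_{\mathscr{C}_v}(C_v,C'_v)$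 and $T_a\psi_{t(a)}\circ f_a=f'_a\circ S_a\psi_{s(a)}$ for all $a\in Q_1$. The resulting (additive) category is $\mathrm{Rep}(Q,\mathscr{R})$. An object $C$ of an additive category $\mathscr{C}$ cancels from direct sums if for all $C',C''\in\mathscr{C}$, $C\oplus C'\cong C\oplus C''$ implies $C'\cong C''$. A ring $R$ is semilocal if $R/\mathrm{Jac}(R)$ is semisimple artinian, where $\mathrm{Jac}(R)$ is the Jacobson radical. *)

(* Defs.v *)
From HB Require Import structures.
From mathcomp Require Import all_boot all_algebra.
From mathcomp Require Import boolp classical_sets.

Set Implicit Arguments.
Unset Strict Implicit.
Unset Printing Implicit Defensive.

Import GRing.Theory.
Local Open Scope ring_scope.
Local Open Scope classical_set_scope.
Local Open Scope quotient_scope.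

(* Rings are [pzRingType]s rather than [nzRingType]s throughout, since the
   endomorphism ring of a zero object is the zero ring. *)
Section JacobsonQuotient.
Variable R : pzRingType.

Definition left_ideal (I : set R) : Prop :=
  [/\ I 0, forall x y, I x -> I y -> I (x + y)
    & forall a x, I x -> I (a * x)].

Definition maximal_left_ideal (M : set R) : Prop :=
  [/\ left_ideal M, M != setT
    & forall I, left_ideal I -> M `<=` I -> I = M \/ I = setT].

(* The left regular module is semisimple: every submodule is a direct
   summand. *)
Definition semisimple_ring : Prop :=
  forall I, left_ideal I -> exists J, [/\ left_ideal J,
    I `&` J = [set 0] & forall x, exists y z, [/\ I y, J z & x = y + z]].

Definition left_artinian : Prop :=
  forall I : nat -> set R, (forall n, left_ideal (I n)) ->
    (forall n, I n.+1 `<=` I n) ->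
    exists n, forall m, (n <= m)%N -> I m = I n.

Definition semisimple_artinian : Prop := semisimple_ring /\ left_artinian.

Definition jac : {pred R} :=
  fun x => `[< forall M, maximal_left_ideal M -> M x >].

Lemma jacP x :
  reflect (forall M, maximal_left_ideal M -> M x) (x \in jac).
Proof. exact: asboolP. Qed.

Lemma left_idealN (I : set R) x : left_ideal I -> I x -> I (- x).
Proof. by case=> _ _ hM Ix; rewrite -mulN1r; apply: hM. Qed.

Fact jac_zmod_closed : zmod_closed jac.
Proof.
split=> [|x y /jacP hx /jacP hy]; apply/jacP => M hM; have [hI _ _] := hM.
  by case: hI.
case: (hI) => _ hD _; apply: hD; first exact: hx.
by apply: left_idealN => //; apply: hy.
Qed.

HB.instance Definition _ := GRing.isZmodClosed.Build R jac jac_zmod_closed.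

Lemma jacMl a x : x \in jac -> a * x \in jac.
Proof.
move=> /jacP hx; apply/jacP => M hM; case: (hM) => -[_ _ hMl] _ _.
by apply: hMl; apply: hx.
Qed.

Lemma jacMr a x : x \in jac -> x * a \in jac.
Proof.
move=> /jacP hx; apply/jacP => M hM; have [hI Mp Mmax] := hM.
have [I0 ID IM] := hI.
have [Ma|Ma] := pselect (M a); first exact: IM.
apply: (hx [set y | M (y * a)]); split.
- by split=> [|y z /= My Mz|b y /= My];
    rewrite /= ?mul0r ?mulrDl -?mulrA //; [apply: ID | apply: IM].
- by apply/eqP => E; apply: Ma; rewrite -[a]mul1r -/([set y | M (y * a)] 1) E.
move=> I hJ sub; have [J0 JD JM] := hJ.
pose K := [set y | exists m b, [/\ M m, I b & y = m + b * a]].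
have hK : left_ideal K.
  split=> [|y z|c y].
  - by exists 0, 0; rewrite mul0r addr0.
  - move=> [m [b [Mm Ib ->]]] [m' [b' [Mm' Ib' ->]]].
    exists (m + m'), (b + b'); split; [exact: ID|exact: JD|].
    by rewrite mulrDl addrACA.
  - move=> [m [b [Mm Ib ->]]]; exists (c * m), (c * b).
    by split; [exact: IM|exact: JM|rewrite mulrDr mulrA].
have MK : M `<=` K by move=> m Mm; exists m, 0; rewrite mul0r addr0.
case: (Mmax _ hK MK) => EK.
  left; apply/seteqP; split=> // b Ib /=; rewrite -EK.
  by exists 0, b; rewrite add0r.
right; apply/seteqP; split=> // b _.
have [m [c [Mm Ic Eb]]] : K (b * a) by rewrite EK.
rewrite -[b](subrK c); apply: JD => //; apply: sub => /=.
by rewrite mulrBl Eb addrK.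
Qed.

Definition mod_jac : Type := Quotient.quot jac.
HB.instance Definition _ := GRing.Zmodule.copy mod_jac (Quotient.quot jac).

Definition to_mod_jac (x : R) : mod_jac := \pi_(Quotient.quot jac) x.
Definition of_mod_jac (u : mod_jac) : R := repr (u : Quotient.quot jac).

Lemma of_mod_jacK : cancel of_mod_jac to_mod_jac.
Proof. exact: reprK. Qed.

Lemma to_mod_jacP x y : to_mod_jac x = to_mod_jac y <-> x - y \in jac.
Proof. by rewrite (Quotient.idealrBE jac); split=> /eqP. Qed.

Fact to_mod_jac_zmod : zmod_morphism to_mod_jac.
Proof. by move=> x y; exact: (raddfB (\pi_(Quotient.quot jac))). Qed.

HB.instance Definition _ :=
  GRing.isZmodMorphism.Build R mod_jac to_mod_jac to_mod_jac_zmod.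

Definition mod_jac_mul (u v : mod_jac) : mod_jac :=
  to_mod_jac (of_mod_jac u * of_mod_jac v).

Lemma to_mod_jacM x y :
  to_mod_jac (x * y) = mod_jac_mul (to_mod_jac x) (to_mod_jac y).
Proof.
apply/to_mod_jacP; set x' := of_mod_jac _; set y' := of_mod_jac _.
have hx : x - x' \in jac by apply/to_mod_jacP; rewrite of_mod_jacK.
have hy : y - y' \in jac by apply/to_mod_jacP; rewrite of_mod_jacK.
rewrite -[x * y](subrK (x' * y)) -mulrBl -addrA -mulrBr.
by rewrite rpredD //; [exact: jacMr|exact: jacMl].
Qed.

Fact mod_jac_mulA : associative mod_jac_mul.
Proof.
move=> u v w; rewrite -[u]of_mod_jacK -[v]of_mod_jacK -[w]of_mod_jacK.
by rewrite -!to_mod_jacM mulrA.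
Qed.

Fact mod_jac_mul1l : left_id (to_mod_jac 1) mod_jac_mul.
Proof. by move=> u; rewrite -[u]of_mod_jacK -to_mod_jacM mul1r. Qed.

Fact mod_jac_mul1r : right_id (to_mod_jac 1) mod_jac_mul.
Proof. by move=> u; rewrite -[u]of_mod_jacK -to_mod_jacM mulr1. Qed.

Fact mod_jac_mulDl : left_distributive mod_jac_mul +%R.
Proof.
move=> u v w; rewrite -[u]of_mod_jacK -[v]of_mod_jacK -[w]of_mod_jacK.
by rewrite -raddfD -!to_mod_jacM mulrDl raddfD.
Qed.

Fact mod_jac_mulDr : right_distributive mod_jac_mul +%R.
Proof.
move=> u v w; rewrite -[u]of_mod_jacK -[v]of_mod_jacK -[w]of_mod_jacK.
by rewrite -raddfD -!to_mod_jacM mulrDr raddfD.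
Qed.

HB.instance Definition _ := GRing.Zmodule_isPzRing.Build mod_jac
  mod_jac_mulA mod_jac_mul1l mod_jac_mul1r mod_jac_mulDl mod_jac_mulDr.

Fact to_mod_jac_monoid : monoid_morphism to_mod_jac.
Proof. by split=> [|x y]; rewrite ?to_mod_jacM. Qed.

HB.instance Definition _ :=
  GRing.isMonoidMorphism.Build R mod_jac to_mod_jac to_mod_jac_monoid.
End JacobsonQuotient.

Definition semilocal (R : pzRingType) : Prop := semisimple_artinian (mod_jac R).

(* Hom-sets are [zmodType]s.  The [choiceType] this includes is no restriction,
   since classically every type has a choice structure.  The zero object and
   the direct sums are part of the structure; functors need not preserve the
   chosen ones. *)
Record addCat := AddCat {
  obj :> Type;
  mor : obj -> obj -> zmodType;
  idm : forall A, mor A A;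
  mcomp : forall A B C, mor B C -> mor A B -> mor A C;
  mcompA : forall A B C D (h : mor C D) (g : mor B C) (f : mor A B),
    mcomp h (mcomp g f) = mcomp (mcomp h g) f;
  mcomp1m : forall A B (f : mor A B), mcomp (idm B) f = f;
  mcompm1 : forall A B (f : mor A B), mcomp f (idm A) = f;
  mcompDl : forall A B C (g g' : mor B C) (f : mor A B),
    mcomp (g + g') f = mcomp g f + mcomp g' f;
  mcompDr : forall A B C (g : mor B C) (f f' : mor A B),
    mcomp g (f + f') = mcomp g f + mcomp g f';
  zobj : obj;
  hom_to_zobj : forall A (f : mor A zobj), f = 0;
  hom_from_zobj : forall A (f : mor zobj A), f = 0;
  dsum : obj -> obj -> obj;
  inj1 : forall A B, mor A (dsum A B);
  inj2 : forall A B, mor B (dsum A B);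
  prj1 : forall A B, mor (dsum A B) A;
  prj2 : forall A B, mor (dsum A B) B;
  prj1_inj1 : forall A B, mcomp (prj1 A B) (inj1 A B) = idm A;
  prj2_inj2 : forall A B, mcomp (prj2 A B) (inj2 A B) = idm B;
  prj1_inj2 : forall A B, mcomp (prj1 A B) (inj2 A B) = 0;
  prj2_inj1 : forall A B, mcomp (prj2 A B) (inj1 A B) = 0;
  inj_prj : forall A B, mcomp (inj1 A B) (prj1 A B)
    + mcomp (inj2 A B) (prj2 A B) = idm (dsum A B)
}.

Arguments mor {_} _ _.
Arguments idm {_} _.
Arguments mcomp {_ _ _ _} _ _.
Arguments zobj {_}.
Arguments dsum {_} _ _.
Arguments inj1 {_} _ _.
Arguments inj2 {_} _ _.
Arguments prj1 {_} _ _.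
Arguments prj2 {_} _ _.

Notation "g '\oc' f" := (mcomp g f) (at level 40, left associativity).

Section AddCatTheory.
Variable C : addCat.
Implicit Types A B D : C.

Lemma mcomp0m A B D (f : mor A B) : (0 : mor B D) \oc f = 0.
Proof. by apply: (addrI (0 \oc f)); rewrite -mcompDl !addr0. Qed.

Lemma mcompm0 A B D (g : mor B D) : g \oc (0 : mor A B) = 0.
Proof. by apply: (addrI (g \oc 0)); rewrite -mcompDr !addr0. Qed.

Lemma mcompNm A B D (g : mor B D) (f : mor A B) : (- g) \oc f = - (g \oc f).
Proof. by apply: (addrI (g \oc f)); rewrite -mcompDl !subrr mcomp0m. Qed.

Lemma mcompmN A B D (g : mor B D) (f : mor A B) : g \oc (- f) = - (g \oc f).
Proof. by apply: (addrI (g \oc f)); rewrite -mcompDr !subrr mcompm0. Qed.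

Definition isomorphic A B : Prop :=
  exists (f : mor A B) (g : mor B A), g \oc f = idm A /\ f \oc g = idm B.

Definition cancels A : Prop :=
  forall B D, isomorphic (dsum A B) (dsum A D) -> isomorphic B D.

Definition endo A : Type := mor A A.
HB.instance Definition _ A := GRing.Zmodule.copy (endo A) (mor A A).
HB.instance Definition _ A := GRing.Zmodule_isPzRing.Build (endo A)
  (@mcompA C A A A A) (@mcomp1m C A A) (@mcompm1 C A A)
  (@mcompDl C A A A) (@mcompDr C A A A).
End AddCatTheory.

Record addFun (C D : addCat) := AddFun {
  fobj :> C -> D;
  fmap : forall A B, mor A B -> mor (fobj A) (fobj B);
  fmap1 : forall A, fmap (idm A) = idm (fobj A);
  fmapM : forall A B E (g : mor B E) (f : mor A B),
    fmap (g \oc f) = fmap g \oc fmap f;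
  fmapD : forall A B (f g : mor A B), fmap (f + g) = fmap f + fmap g
}.

Arguments fmap {_ _} _ {_ _} _.

Section AddFunTheory.
Variables (C D : addCat) (F : addFun C D).

Lemma fmap0 (A B : C) : fmap F (0 : mor A B) = 0.
Proof. by apply: (addrI (fmap F 0)); rewrite -fmapD !addr0. Qed.

Lemma fmapN (A B : C) (f : mor A B) : fmap F (- f) = - fmap F f.
Proof. by apply: (addrI (fmap F f)); rewrite -fmapD !subrr fmap0. Qed.
End AddFunTheory.

Record quiver := Quiver {
  vertex : finType;
  edge : Type;
  source : edge -> vertex;
  target : edge -> vertex
}.

Arguments source {_} _.
Arguments target {_} _.

Record realization (Q : quiver) := Realization {
  vcat : vertex Q -> addCat;
  ecat : edge Q -> addCat;
  sfun : forall a, addFun (vcat (source a)) (ecat a);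
  tfun : forall a, addFun (vcat (target a)) (ecat a)
}.

Arguments vcat {_} _ _.
Arguments ecat {_} _ _.
Arguments sfun {_} _ _.
Arguments tfun {_} _ _.

Section Representations.
Variables (Q : quiver) (R : realization Q).

Record rep := MkRep {
  robj :> forall v, vcat R v;
  rarr : forall a, mor (sfun R a (robj (source a))) (tfun R a (robj (target a)))
}.

Record rep_hom (X Y : rep) := RepHom {
  rmor :> forall v, mor (X v) (Y v);
  rmorE : forall a, fmap (tfun R a) (rmor (target a)) \oc rarr X a
                  = rarr Y a \oc fmap (sfun R a) (rmor (source a))
}.

Lemma rep_homP X Y (f g : rep_hom X Y) : (forall v, f v = g v) -> f = g.
Proof.
case: f g => [f hf] [g hg] /= efg.
have E : f = g by exact: functional_extensionality_dep.
by case: _ / E hg => hg; congr RepHom; exact: Prop_irrelevance.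
Qed.

HB.instance Definition _ X Y := gen_eqMixin (rep_hom X Y).
HB.instance Definition _ X Y := gen_choiceMixin (rep_hom X Y).

Section HomZmodule.
Variables X Y : rep.

Program Definition rep_hom0 : rep_hom X Y := RepHom (rmor := fun=> 0) _.
Next Obligation. by rewrite !fmap0 mcomp0m mcompm0. Qed.

Program Definition rep_homN (f : rep_hom X Y) : rep_hom X Y :=
  RepHom (rmor := fun v => - f v) _.
Next Obligation. by rewrite !fmapN mcompNm mcompmN rmorE. Qed.

Program Definition rep_homD (f g : rep_hom X Y) : rep_hom X Y :=
  RepHom (rmor := fun v => f v + g v) _.
Next Obligation. by rewrite !fmapD mcompDl mcompDr !rmorE. Qed.

Fact rep_homDA : associative rep_homD.
Proof. by move=> f g h; apply: rep_homP => v /=; rewrite addrA. Qed.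

Fact rep_homDC : commutative rep_homD.
Proof. by move=> f g; apply: rep_homP => v /=; rewrite addrC. Qed.

Fact rep_hom0D : left_id rep_hom0 rep_homD.
Proof. by move=> f; apply: rep_homP => v /=; rewrite add0r. Qed.

Fact rep_homND : left_inverse rep_hom0 rep_homN rep_homD.
Proof. by move=> f; apply: rep_homP => v /=; rewrite addNr. Qed.

HB.instance Definition _ := GRing.isZmodule.Build (rep_hom X Y)
  rep_homDA rep_homDC rep_hom0D rep_homND.
End HomZmodule.

Program Definition rep_id X : rep_hom X X :=
  RepHom (rmor := fun v => idm (X v)) _.
Next Obligation. by rewrite !fmap1 mcomp1m mcompm1. Qed.

Program Definition rep_comp X Y Z (g : rep_hom Y Z) (f : rep_hom X Y) :
  rep_hom X Z := RepHom (rmor := fun v => g v \oc f v) _.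
Next Obligation. by rewrite !fmapM -mcompA rmorE !mcompA rmorE. Qed.

Definition rep_zero : rep := MkRep (robj := fun=> zobj) (fun=> 0).

Definition rep_dsum (X Y : rep) : rep :=
  MkRep (robj := fun v => dsum (X v) (Y v)) (fun a =>
    fmap (tfun R a) (inj1 _ _) \oc rarr X a \oc fmap (sfun R a) (prj1 _ _)
  + fmap (tfun R a) (inj2 _ _) \oc rarr Y a \oc fmap (sfun R a) (prj2 _ _)).

Program Definition rep_inj1 X Y : rep_hom X (rep_dsum X Y) :=
  RepHom (rmor := fun v => inj1 (X v) (Y v)) _.
Next Obligation.
rewrite mcompDl -!mcompA -!fmapM prj1_inj1 prj2_inj1.
by rewrite fmap1 fmap0 !mcompm0 mcompm1 addr0.
Qed.

Program Definition rep_inj2 X Y : rep_hom Y (rep_dsum X Y) :=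
  RepHom (rmor := fun v => inj2 (X v) (Y v)) _.
Next Obligation.
rewrite mcompDl -!mcompA -!fmapM prj1_inj2 prj2_inj2.
by rewrite fmap1 fmap0 !mcompm0 mcompm1 add0r.
Qed.

Program Definition rep_prj1 X Y : rep_hom (rep_dsum X Y) X :=
  RepHom (rmor := fun v => prj1 (X v) (Y v)) _.
Next Obligation.
rewrite mcompDr !mcompA -!fmapM prj1_inj1 prj1_inj2.
by rewrite fmap1 fmap0 !mcomp0m mcomp1m addr0.
Qed.

Program Definition rep_prj2 X Y : rep_hom (rep_dsum X Y) Y :=
  RepHom (rmor := fun v => prj2 (X v) (Y v)) _.
Next Obligation.
rewrite mcompDr !mcompA -!fmapM prj2_inj1 prj2_inj2.
by rewrite fmap1 fmap0 !mcomp0m mcomp1m add0r.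
Qed.

Program Definition Rep : addCat := {|
  obj := rep;
  mor X Y := rep_hom X Y : zmodType;
  idm := rep_id;
  mcomp := rep_comp;
  zobj := rep_zero;
  dsum := rep_dsum;
  inj1 := rep_inj1;
  inj2 := rep_inj2;
  prj1 := rep_prj1;
  prj2 := rep_prj2
|}.
Next Obligation. by apply: rep_homP => v /=; rewrite mcompA. Qed.
Next Obligation. by apply: rep_homP => v /=; rewrite mcomp1m. Qed.
Next Obligation. by apply: rep_homP => v /=; rewrite mcompm1. Qed.
Next Obligation. by apply: rep_homP => v /=; rewrite mcompDl. Qed.
Next Obligation. by apply: rep_homP => v /=; rewrite mcompDr. Qed.
Next Obligation. by apply: rep_homP => v /=; exact: hom_to_zobj. Qed.
Next Obligation. by apply: rep_homP => v /=; exact: hom_from_zobj. Qed.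
Next Obligation. by apply: rep_homP => v /=; exact: prj1_inj1. Qed.
Next Obligation. by apply: rep_homP => v /=; exact: prj2_inj2. Qed.
Next Obligation. by apply: rep_homP => v /=; exact: prj1_inj2. Qed.
Next Obligation. by apply: rep_homP => v /=; exact: prj2_inj1. Qed.
Next Obligation. by apply: rep_homP => v /=; exact: inj_prj. Qed.
End Representations.

(* Main.v *)
(** By Evans' argument it is enough that the endomorphism ring [E] of [rho] has
    stable range 1.  A morphism of representations is invertible as soon as its
    components are, so [E] maps to the finite product of the semisimple rings
    [End(C_v)/Jac] reflecting units.  In a semisimple ring the left annihilator
    of [u - u g u] contains that of [u], strictly unless [1 - u g] is a unit;
    left ideals being noetherian, this yields a chain condition on [E]
    ([rank_acc]) that mentions only the ring operations and units, in the style
    of Camps and Dicks.  It descends to [E/Jac(E)].  There, given [a x + b = 1],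
    modify [a] within [a + bE] and [x] so that [p = 1 - a x] in [bE] is maximal
    for the chain condition; with [q = 1 - x a], maximality forces [p a = 0],
    [x p = 0] and [p E q = 0], hence [q E p = 0], and then the descending
    idempotents [a^k x^k] show that [p = 0]. *)

Require Import Defs.
From HB Require Import structures.
From mathcomp Require Import all_boot all_algebra.
From mathcomp Require Import boolp classical_sets.

Set Implicit Arguments.
Unset Strict Implicit.
Unset Printing Implicit Defensive.

Import GRing.Theory.
Local Open Scope ring_scope.
Local Open Scope classical_set_scope.

(** * Units, stable range 1 and the chain condition on elements *)

Section Invertible.
Variable R : pzRingType.
Implicit Types a b c g p q r t u v w x y z : R.

Definition invertible u := exists v, v * u = 1 /\ u * v = 1.

Lemma invertible_lr u v w : v * u = 1 -> u * w = 1 -> invertible u.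
Proof.
move=> vu uw; exists v; split=> //.
by rewrite -[v]mulr1 -uw (mulrA v) vu mul1r.
Qed.

(** Jacobson's identity: if [s] inverts [1 - a * t], then [1 + t * s * a] inverts [1 - t * a]. *)
Lemma invertible_1BC a t : invertible (1 - a * t) -> invertible (1 - t * a).
Proof.
move=> [s [sl sr]]; exists (1 + t * s * a); split.
  have -> : (1 + t * s * a) * (1 - t * a) =
            1 - t * a + t * (s * (1 - a * t)) * a.
    by rewrite mulrDl mul1r !mulrBr !mulr1 mulrBl !mulrA.
  by rewrite sl mulr1 subrK.
have -> : (1 - t * a) * (1 + t * s * a) =
          1 - t * a + t * ((1 - a * t) * s) * a.
  by rewrite mulrDr mulr1 !mulrBl !mul1r mulrBr mulrBl !mulrA.
by rewrite sr mulr1 subrK.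
Qed.

Lemma invertible_1B_sq0 u : u * u = 0 -> invertible (1 - u).
Proof.
move=> uu; exists (1 + u); split.
  by rewrite mulrDl mul1r mulrBr mulr1 uu subr0 subrK.
by rewrite mulrDr mulr1 mulrBl mul1r uu subr0 subrK.
Qed.

(** Vanishing of the Jacobson radical, in the quasi-regularity form that avoids maximal ideals. *)
Definition jac_trivial := forall a, (forall t, invertible (1 - a * t)) -> a = 0.

Definition stable_range1 :=
  forall a x b, a * x + b = 1 -> exists y, invertible (a + b * y).

(* A chain condition in the spirit of Camps and Dicks, who use an integer valued
   rank function that strictly decreases along [u |-> u - u g u] whenever
   [1 - u g] is not invertible. *)
Definition rank_acc := forall P : set R, P !=set0 ->
  exists2 u, P u & forall g, P (u - u * g * u) -> invertible (1 - u * g).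

Lemma expr_idem_defect a x k :
  a ^+ k.+1 * x ^+ k.+1 = a ^+ k * x ^+ k - a ^+ k * (1 - a * x) * x ^+ k.
Proof. by rewrite exprSr exprS mulrBr mulr1 mulrBl opprB addrC subrK !mulrA. Qed.

(* The idempotents [a^k x^k] form a descending sequence with successive
   differences [a^k p x^k]; by [rank_acc] it is stationary, so [p] vanishes. *)
Lemma right_inverse_of_rank_acc a x (p := 1 - a * x) : rank_acc -> p * p = p ->
  (forall k, x ^+ k * a ^+ k * p = p) -> (forall k, p * (x ^+ k * a ^+ k) = p) ->
  a * x = 1.
Proof.
move=> acc pp pl pr; apply/eqP; rewrite eq_sym -subr_eq0 -/p; apply/eqP.
have [|_ [k _ <-] max] := acc [set a ^+ k * x ^+ k | k in [set: nat]].
  by exists (a ^+ 0 * x ^+ 0), 0%N.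
pose g := a ^+ k * p * x ^+ k.
have cg : a ^+ k * x ^+ k * g = g.
  rewrite /g; transitivity (a ^+ k * (x ^+ k * a ^+ k * p) * x ^+ k).
    by rewrite !mulrA.
  by rewrite pl.
have gc : g * (a ^+ k * x ^+ k) = g.
  rewrite /g; transitivity (a ^+ k * (p * (x ^+ k * a ^+ k)) * x ^+ k).
    by rewrite !mulrA.
  by rewrite pr.
have [|s [sl _]] := max g.
  by rewrite cg gc -expr_idem_defect; exists k.+1.
have akp0 : a ^+ k * p = 0.
  rewrite -[a ^+ k * p]mul1r -sl cg -mulrA mulrBl mul1r.
  suff -> : g * (a ^+ k * p) = a ^+ k * p by rewrite subrr mulr0.
  transitivity (a ^+ k * (p * (x ^+ k * a ^+ k)) * p); first by rewrite !mulrA.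
  by rewrite pr -mulrA pp.
by rewrite -(pl k) -mulrA akp0 mulr0.
Qed.

(** Dedekind finiteness, from the previous lemma with [a] and [x] exchanged: since
    [a ^+ k * x ^+ k = 1], its hypotheses on [p] become trivial. *)
Lemma invertible_of_right_inverse a x : rank_acc -> a * x = 1 -> invertible a.
Proof.
move=> acc ax.
have axk k : a ^+ k * x ^+ k = 1.
  elim: k => [|k IH]; first by rewrite mulr1.
  by rewrite expr_idem_defect IH ax subrr mulr0 mul0r subr0.
exists x; split=> //; apply: right_inverse_of_rank_acc => // [|k|k].
- rewrite mulrBl mul1r mulrBr mulr1.
  by rewrite -(mulrA x a) (mulrA a x a) ax mul1r subrr subr0.
- by rewrite axk mul1r.
- by rewrite axk mulr1.
Qed.

(** Perturbing [a] by [p * w * q] and [x] by [q * v * p] gives a new defect of the shape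
    [p - p * g * p] that [rank_acc] tests. *)
Lemma defect_mul a x p q w v :
  p = 1 - a * x -> a * q = p * a -> q * x = x * p ->
  1 - (a + p * w * q) * (x + q * v * p) =
  p - p * (a * v + w * x + w * q * q * v) * p.
Proof.
move=> Ep aq qx; have -> : (a + p * w * q) * (x + q * v * p) =
    a * x + p * (a * v + w * x + w * q * q * v) * p.
  rewrite mulrDl !mulrDr !mulrDl -!addrA; congr (_ + _).
  rewrite !mulrA aq; congr (_ + _).
  by rewrite -(mulrA (p * w) q x) qx !mulrA.
by rewrite opprD addrA -Ep.
Qed.

Lemma stable_range1_of_rank_acc : jac_trivial -> rank_acc -> stable_range1.
Proof.
move=> J0 acc a0 x0 b0 ab1.
pose P := [set p | exists a x y z,
  [/\ a = a0 + b0 * y, p = 1 - a * x & p = b0 * z]].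
have [|p [a [x [y [z [Ea Ep Eb]]]]] max] := acc P.
  exists b0, a0, x0, 0, 1; rewrite mulr0 addr0 mulr1; split=> //.
  by rewrite -ab1 addrAC subrr add0r.
set q := 1 - x * a; have Eq : q = 1 - x * a by [].
have aq : a * q = p * a by rewrite Ep mulrBr mulr1 mulrBl mul1r mulrA.
have qx : q * x = x * p by rewrite Ep mulrBr mulr1 mulrBl mul1r mulrA.
clearbody q.
(* The new defect stays in [b0 R], being [p] times [1 - g * p]; hence maximality of [p] applies for
   all [w] and [v]. *)
have {max} inv w v : invertible (1 - p * (a * v + w * x + w * q * q * v)).
  apply: max; exists (a + p * w * q), (x + q * v * p), (y + z * w * q).
  exists (z * (1 - (a * v + w * x + w * q * q * v) * p)).
  split; first by rewrite Ea Eb mulrDr addrA !mulrA.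
    by rewrite (defect_mul w v Ep aq qx).
  by rewrite mulrA -Eb mulrBr mulr1 mulrA.
have pa : p * a = 0.
  by apply: J0 => t; have := inv 0 t; rewrite !mul0r !addr0 mulrA.
have xp : x * p = 0.
  apply: J0 => t; rewrite -mulrA; apply: invertible_1BC.
  by have := inv t 0; rewrite !mulr0 add0r addr0 mulrA.
have qq : q * q = q.
  by rewrite {1}Eq mulrBl mul1r -mulrA aq pa mulr0 subr0.
have pp : p * p = p.
  by rewrite {2}Ep mulrBr mulr1 mulrA pa mul0r subr0.
(* With [w * q] in place of [w], the first two terms vanish by [pa] and [xp], leaving
   [1 - p * w * q * v]. *)
have pwq w : p * w * q = 0.
  apply: J0 => v; have := inv (w * q) v.
  rewrite !mulrDr !mulrA pa mul0r add0r -(mulrA _ q x) qx xp mulr0 add0r.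
  by do 2!rewrite -(mulrA _ q q) qq.
(* The square of [q * w * p * t] contains the factor [p * t * q], which is 0. *)
have qwp w : q * w * p = 0.
  apply: J0 => t; apply: invertible_1B_sq0.
  transitivity (q * w * (p * t * q) * w * p * t); first by rewrite !mulrA.
  by rewrite pwq mulr0 !mul0r.
(* [x ^+ k * a ^+ k] is 1 minus a sum of terms [x ^+ j * q * a ^+ j], which [p] annihilates on both
   sides by [qwp] and [pwq]. *)
have ax : a * x = 1.
  apply: right_inverse_of_rank_acc acc _ _ _; rewrite -Ep // => k.
    elim: k => [|k IH]; first by rewrite !mul1r.
    have -> : x ^+ k.+1 * a ^+ k.+1 * p =
       x ^+ k * a ^+ k * p - x ^+ k * (q * a ^+ k * p).
      by rewrite expr_idem_defect -Eq mulrBl !mulrA.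
    by rewrite IH qwp mulr0 subr0.
  elim: k => [|k IH]; first by rewrite !mulr1.
  have -> : p * (x ^+ k.+1 * a ^+ k.+1) =
       p * (x ^+ k * a ^+ k) - p * x ^+ k * q * a ^+ k.
    by rewrite expr_idem_defect -Eq mulrBr !mulrA.
  by rewrite IH pwq mul0r subr0.
by exists y; rewrite -Ea; apply: invertible_of_right_inverse ax.
Qed.

End Invertible.

(** * The Jacobson radical: lifting units, and descent to the quotient *)

Section Jacobson.
Variable R : pzRingType.
Implicit Types (I J M : set R) (a t u : R).

Lemma exists_maximal_left_ideal I : left_ideal I -> ~ I 1 ->
  exists2 M, maximal_left_ideal M & I `<=` M.
Proof.
move=> hI I1; have [I0 ID IM] := hI.
(* Joining [I] to the members makes the empty chain harmless. *)
pose P := [set A : set R | left_ideal (I `|` A) /\ ~ (I `|` A) 1].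
have [F FP chF|A [[hA A1] Amax]] := @Zorn_bigcup R P.
  split; last by case=> // -[X FX X1]; have [_ []] := FP _ FX; right.
  split; [by left | | ].
    move=> x y [Ix|[X FX Xx]] [Iy|[Y FY Yy]].
    - by left; apply: ID.
    - have [[_ D _] _] := FP _ FY.
      by have [|Z] := D x y (or_introl Ix) (or_intror Yy); [left|right; exists Y].
    - have [[_ D _] _] := FP _ FX.
      by have [|Z] := D x y (or_intror Xx) (or_introl Iy); [left|right; exists X].
    - have [XY|YX] := chF X Y FX FY.
        have [[_ D _] _] := FP _ FY.
        have [|Z] := D x y (or_intror (XY _ Xx)) (or_intror Yy); first by left.
        by right; exists Y.
      have [[_ D _] _] := FP _ FX.
      have [|Z] := D x y (or_intror Xx) (or_intror (YX _ Yy)); first by left.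
      by right; exists X.
  move=> a x [Ix|[X FX Xx]]; first by left; apply: IM.
  have [[_ _ D] _] := FP _ FX.
  by have [|Z] := D a x (or_intror Xx); [left|right; exists X].
exists (I `|` A); last by left.
split=> // [|J hJ sJ].
  by apply/eqP => E; apply: A1; rewrite E.
have [J1|J1] := pselect (J 1).
  right; apply/seteqP; split=> // x _; rewrite -[x]mulr1.
  by case: hJ => _ _; apply.
left; have IJ : I `|` J = J.
  by apply/seteqP; split=> [x [Ix|//]|x]; [apply: sJ; left | right].
have AJ : A `<=` J by move=> x Ax; apply: sJ; right.
have [JA|JA] := pselect (J `<=` A).
  by apply/seteqP; split=> // x Jx; right; apply: JA.
by case: (Amax J); [split | split; rewrite IJ].
Qed.

(** Otherwise [R (1 - j)] lies in a maximal left ideal, which also contains [j], hence 1. *)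
Lemma jac_left_inverse j : j \in @jac R -> exists s, s * (1 - j) = 1.
Proof.
move=> /jacP hj.
pose I := [set s * (1 - j) | s in [set: R]].
have hI : left_ideal I.
  split=> [|_ _ [s _ <-] [t _ <-]|a _ [s _ <-]].
  - by exists 0; rewrite ?mul0r.
  - by exists (s + t); rewrite ?mulrDl.
  - by exists (a * s); rewrite ?mulrA.
have [[s _ sj]|I1] := pselect (I 1); first by exists s.
have [M mM IM] := exists_maximal_left_ideal hI I1.
have [[M0 MD MM] MT _] := mM; case/eqP: MT; apply/seteqP; split=> // x _.
rewrite -[x]mulr1; apply: MM; rewrite -(subrK j 1); apply: MD; last exact: hj.
by apply: IM; exists 1; rewrite ?mul1r.
Qed.

Lemma jac_invertible_1B j : j \in @jac R -> invertible (1 - j).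
Proof.
move=> hj; have [s sj] := jac_left_inverse hj.
(* The left inverse [s] again has the form 1 minus a radical element, so it has a left inverse too,
   which must be [1 - j]. *)
have Es : s = 1 - (- (s * j)) by rewrite opprK -sj mulrBr mulr1 subrK.
have [|t ts] := @jac_left_inverse (- (s * j)); first by rewrite rpredN jacMl.
rewrite -Es in ts.
have Et : t = 1 - j by rewrite -[RHS]mul1r -{1}ts -mulrA sj mulr1.
by exists s; split=> //; rewrite -Et.
Qed.

(** If a maximal [M] misses [a], then [M + R a = R], so [M] contains some unit [1 - t * a]. *)
Lemma jac_of_invertible_1B a : (forall t, invertible (1 - t * a)) -> a \in @jac R.
Proof.
move=> inv; apply/jacP => M [hM MT Mmax]; have [M0 MD MM] := hM.
have [//|Ma] := pselect (M a).
pose I := [set y | exists m t, M m /\ y = m + t * a].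
have hI : left_ideal I.
  split=> [|_ _ [m [t [Mm ->]]] [n [s [Mn ->]]]|b _ [m [t [Mm ->]]]].
  - by exists 0, 0; rewrite mul0r addr0.
  - by exists (m + n), (t + s); rewrite mulrDl addrACA; split=> //; apply: MD.
  - by exists (b * m), (b * t); rewrite mulrDr mulrA; split=> //; apply: MM.
have [|EI|EI] := Mmax I hI.
- by move=> m Mm; exists m, 0; rewrite mul0r addr0.
- by case: Ma; rewrite -EI; exists 0, 1; rewrite mul1r add0r.
have [m [t [Mm Et]]] : I 1 by rewrite EI.
have [s [st _]] := inv t.
case/eqP: MT; apply/seteqP; split=> // x _; rewrite -[x]mulr1; apply: (MM).
by rewrite -st; apply: MM; rewrite Et addrK.
Qed.

Lemma invertible_mod_jac u : invertible (to_mod_jac u) -> invertible u.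
Proof.
move=> [v [vu uv]]; rewrite -[v]of_mod_jacK in vu uv; set w := of_mod_jac v.
have inv (x : R) : to_mod_jac x = to_mod_jac 1 -> invertible x.
  move=> /esym/to_mod_jacP/jac_invertible_1B.
  by rewrite opprB addrC subrK.
have [|s [swu _]] := inv (w * u); first by rewrite rmorphM.
have [|t [_ uwt]] := inv (u * w); first by rewrite rmorphM.
by apply: (@invertible_lr _ u (s * w) (w * t)); rewrite ?mulrA // -mulrA.
Qed.

Lemma invertible_to_mod_jac u : invertible u -> invertible (to_mod_jac u).
Proof.
by move=> [v [vu uv]]; exists (to_mod_jac v); rewrite -!rmorphM vu uv rmorph1.
Qed.

Lemma jac_trivial_mod_jac : jac_trivial (mod_jac R).
Proof.
move=> a inv; rewrite -[a]of_mod_jacK -(raddf0 (@to_mod_jac R)).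
apply/to_mod_jacP; rewrite subr0; apply: jac_of_invertible_1B => t.
apply: invertible_1BC; apply: invertible_mod_jac.
by rewrite rmorphB rmorph1 rmorphM /= of_mod_jacK.
Qed.

Lemma rank_acc_mod_jac : rank_acc R -> rank_acc (mod_jac R).
Proof.
move=> acc P [p0 Pp0].
have [|u Pu max] := acc [set u | P (to_mod_jac u)].
  by exists (of_mod_jac p0); rewrite /= of_mod_jacK.
exists (to_mod_jac u) => // g Pg; rewrite -[g]of_mod_jacK.
rewrite -(rmorph1 (@to_mod_jac R)) -rmorphM -rmorphB.
apply: invertible_to_mod_jac; apply: max.
by rewrite /= rmorphB !rmorphM /= of_mod_jacK.
Qed.

Lemma rank_acc_stable_range1 : rank_acc R -> stable_range1 R.
Proof.
move=> /rank_acc_mod_jac/(stable_range1_of_rank_acc jac_trivial_mod_jac) sr.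
move=> a x b axb.
have [|y] := sr (to_mod_jac a) (to_mod_jac x) (to_mod_jac b).
  by rewrite -rmorphM -rmorphD axb rmorph1.
rewrite -[y]of_mod_jacK -rmorphM -rmorphD => /invertible_mod_jac inv.
by exists (of_mod_jac y).
Qed.

End Jacobson.

(** * Chain conditions in semisimple rings and their transfer along maps reflecting units *)

Section Semisimple.
Variable T : pzRingType.
Hypothesis ssT : semisimple_artinian T.
Implicit Types (I : set T) (r u w g : T).

(** [e] is the component of 1 in [I]; then [y - y * e] lies in both [I] and its complement. *)
Lemma left_ideal_idempotent I : left_ideal I ->
  exists2 e, I e & forall y, I y -> y = y * e.
Proof.
move=> hI; have [J [hJ IJ ex]] := ssT.1 I hI.
have [I0 ID IM] := hI; have [J0 JD JM] := hJ.
have [e [z [Ie Jz E1]]] := ex 1; exists e => // y Iy.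
apply/eqP; rewrite -subr_eq0; apply/eqP.
have Ey : y - y * e = y * z by rewrite -{1}[y]mulr1 E1 mulrDr addrAC subrr add0r.
suff : (I `&` J) (y - y * e) by rewrite IJ.
split; last by rewrite Ey; apply: JM.
by apply: ID => //; apply: left_idealN => //; apply: IM.
Qed.

(** The union of the chain is generated by one element, which already lies in some [I n]. *)
Lemma left_ideal_ascending (I : nat -> set T) : (forall n, left_ideal (I n)) ->
  (forall n, I n `<=` I n.+1) ->
  exists n, forall m, (n <= m)%N -> I m `<=` I n.
Proof.
move=> hI inc.
have le m n : (m <= n)%N -> I m `<=` I n.
  move=> /subnK <-; elim: (n - m)%N => [|k IH] //.
  by apply: subset_trans IH _; rewrite addSn.
have [|e [n _ Ie] He] := @left_ideal_idempotent (\bigcup_n I n).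
  split=> [|x y [m _ Imx] [n _ Iny]|a x [n _ Inx]].
  - by exists 0%N => //; case: (hI 0%N).
  - exists (maxn m n) => //; case: (hI (maxn m n)) => _ D _.
    by apply: D; [apply: le Imx; apply: leq_maxl | apply: le Iny; apply: leq_maxr].
  - by exists n => //; case: (hI n) => _ _; apply.
exists n => m _ x Ix; rewrite (He x); last by exists m.
by case: (hI n) => _ _; apply.
Qed.

Definition lann u : set T := [set r | r * u = 0].

Lemma left_ideal_lann u : left_ideal (lann u).
Proof.
rewrite /lann; split=> /= [|x y xu yu|a x xu]; first by rewrite mul0r.
  by rewrite mulrDl xu yu addr0.
by rewrite -mulrA xu mulr0.
Qed.

(** The chain [T w^n] stabilises, so [t * w ^+ n.+1 = w ^+ n]; cancelling powers of [w] on the right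
    makes [t] an inverse. *)
Lemma invertible_lann0 w : lann w `<=` [set 0] -> invertible w.
Proof.
move=> w0; pose I n := [set s * w ^+ n | s in [set: T]].
have [|n|n st] := ssT.2 I.
- move=> n; split=> [|_ _ [s _ <-] [t _ <-]|a _ [s _ <-]].
  + by exists 0; rewrite ?mul0r.
  + by exists (s + t); rewrite ?mulrDl.
  + by exists (a * s); rewrite ?mulrA.
- by move=> _ [s _ <-]; exists (s * w) => //; rewrite exprS mulrA.
have lannX k r : r * w ^+ k = 0 -> r = 0.
  elim: k r => [|k IH] r; first by rewrite mulr1.
  by rewrite exprS mulrA => /IH; apply: w0.
have [t _ tw] : I n.+1 (w ^+ n) by rewrite st //; exists 1; rewrite ?mul1r.
have tw1 : t * w = 1.
  apply/eqP; rewrite -subr_eq0; apply/eqP; apply: (lannX n).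
  by rewrite mulrBl mul1r -mulrA -exprS tw subrr.
exists t; split=> //; apply/eqP; rewrite -subr_eq0; apply/eqP; apply: w0.
by rewrite /lann /= mulrBl mul1r -mulrA tw1 mulr1 subrr.
Qed.

Lemma lann_defect u g : lann u `<=` lann (u - u * g * u).
Proof. by move=> r; rewrite /lann /= mulrBr !mulrA => ->; rewrite !mul0r subr0. Qed.

Lemma lann_defect_strict u g :
  lann (u - u * g * u) `<=` lann u -> invertible (1 - u * g).
Proof.
move=> le; apply: invertible_lann0 => r; rewrite /lann /= mulrBr mulr1 => /eqP.
rewrite subr_eq0 => /eqP rE.
suff ru0 : r * u = 0 by rewrite rE mulrA ru0 mul0r.
by apply: le; rewrite /lann /= mulrBr (mulrA r) -rE subrr.
Qed.

End Semisimple.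

(** Without a maximal element, choice yields an endless sequence of defects whose annihilators
    ascend in every [T i]. Where they are all stationary, [1 - u * g] is a unit in each factor,
    hence in [E], a contradiction. *)
Lemma rank_acc_reflect (E : pzRingType) (I : finType) (T : I -> pzRingType)
    (f : forall i, {rmorphism E -> T i}) :
  (forall i, semisimple_artinian (T i)) ->
  (forall u, (forall i, invertible (f i u)) -> invertible u) -> rank_acc E.
Proof.
move=> ssT refl P [u0 Pu0]; apply: contrapT => noM.
have step (u : {u | P u}) : exists w : {u | P u},
    (exists g, sval w = sval u - sval u * g * sval u /\
      ~ invertible (1 - sval u * g)).
  case: u => u Pu /=; apply: contrapT => no; apply: noM.
  exists u => // g Pg; apply: contrapT => ninv; apply: no.
  by exists (exist _ _ Pg), g.
have {step} [next nextP] := choice step.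
pose U n : E := sval (iter n next (exist _ _ Pu0)).
have asc i n : lann (f i (U n)) `<=` lann (f i (U n.+1)).
  rewrite /U /=; have [g [-> _]] := nextP (iter n next (exist _ _ Pu0)).
  by rewrite rmorphB !rmorphM; apply: lann_defect.
have [N stat] : exists N : I -> nat, forall i m, (N i <= m)%N ->
    lann (f i (U m)) `<=` lann (f i (U (N i))).
  suff /choice[N] : forall i, exists n, forall m, (n <= m)%N ->
      lann (f i (U m)) `<=` lann (f i (U n)) by exists N.
  move=> i; apply: (left_ideal_ascending (ssT i)) => n; last exact: asc.
  exact: left_ideal_lann.
(* Finiteness of [I] gives a stage common to all factors. *)
pose n := (\max_i N i)%N.
have [g [Eg]] := nextP (iter n next (exist _ _ Pu0)); apply.
apply: refl => i; rewrite rmorphB rmorph1 rmorphM.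
apply: (lann_defect_strict (ssT i)); rewrite -!rmorphM -rmorphB -Eg.
have le : (N i <= n)%N by apply: leq_bigmax.
apply: subset_trans (stat i n.+1 (leqW le)) _.
have incr m k : lann (f i (U m)) `<=` lann (f i (U (k + m)%N)).
  by elim: k => [|k IH] //; apply: subset_trans IH _; apply: asc.
by have := incr (N i) (n - N i)%N; rewrite subnK.
Qed.

(** * Evans' cancellation argument in an additive category *)

Section Evans.
Variable C : addCat.
Implicit Types A B D : C.

(** Block matrix multiplication through the middle object [dsum A D]. *)
Lemma mcomp_dsum W X Y A D (h : mor Y W) (g : mor (dsum A D) Y)
    (f : mor X (dsum A D)) V (k : mor V X) :
  (h \oc g \oc inj1 A D) \oc (prj1 A D \oc f \oc k)
  + (h \oc g \oc inj2 A D) \oc (prj2 A D \oc f \oc k) = h \oc (g \oc f) \oc k.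
Proof.
rewrite -[f in RHS]mcomp1m -inj_prj mcompDl !mcompDr mcompDl.
by rewrite !mcompA.
Qed.

(* [B -> D] is the Schur complement of the invertible corner, and its inverse is
   the corresponding entry of [psi]. *)
Lemma isomorphic_of_invertible_corner A B D
    (phi : mor (dsum A B) (dsum A D)) (psi : mor (dsum A D) (dsum A B)) :
  psi \oc phi = idm _ -> phi \oc psi = idm _ ->
  invertible (prj1 A D \oc phi \oc inj1 A B : endo A) -> isomorphic B D.
Proof.
set u := _ \oc _ \oc _ => psiphi phipsi [w [wu uw]].
rewrite -[LHS]/(w \oc u) -[RHS]/(idm A) in wu.
rewrite -[LHS]/(u \oc w) -[RHS]/(idm A) in uw.
pose beta := prj1 A D \oc phi \oc inj2 A B.
pose gamma := prj2 A D \oc phi \oc inj1 A B.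
pose delta := prj2 A D \oc phi \oc inj2 A B.
pose b := prj1 A B \oc psi \oc inj2 A D.
pose c := prj2 A B \oc psi \oc inj1 A D.
pose d := prj2 A B \oc psi \oc inj2 A D.
(* These four identities are block entries of [phi \oc psi = 1] and [psi \oc phi = 1]. *)
have bd0 : beta \oc d = - (u \oc b).
  apply/eqP; rewrite -addr_eq0 addrC; apply/eqP.
  rewrite mcomp_dsum phipsi mcompm1; exact: prj1_inj2.
have dg0 : d \oc gamma = - (c \oc u).
  apply/eqP; rewrite -addr_eq0 addrC; apply/eqP.
  rewrite mcomp_dsum psiphi mcompm1; exact: prj2_inj1.
have bd1 : gamma \oc b + delta \oc d = idm D.
  rewrite mcomp_dsum phipsi mcompm1; exact: prj2_inj2.
have dg1 : c \oc beta + d \oc delta = idm B.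
  rewrite mcomp_dsum psiphi mcompm1; exact: prj2_inj2.
clearbody u beta gamma delta b c d.
exists (delta - gamma \oc w \oc beta), d; split.
  rewrite mcompDr mcompmN !mcompA dg0 !mcompNm opprK -(mcompA c) uw mcompm1.
  by rewrite addrC.
rewrite mcompDl mcompNm -!mcompA bd0 !mcompmN opprK (mcompA w) wu mcomp1m.
by rewrite addrC.
Qed.

Lemma cancels_of_stable_range1 A : stable_range1 (endo A) -> cancels A.
Proof.
move=> sr B D [phi [psi [psiphi phipsi]]].
pose alpha : endo A := prj1 A D \oc phi \oc inj1 A B.
pose beta := prj1 A D \oc phi \oc inj2 A B.
pose a : endo A := prj1 A B \oc psi \oc inj1 A D.
pose c := prj2 A B \oc psi \oc inj1 A D.
have [|y inv] := sr alpha a (beta \oc c).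
  transitivity (alpha \oc a + beta \oc c) => //.
  transitivity (idm A) => //.
  rewrite mcomp_dsum phipsi mcompm1; exact: prj1_inj1.
(* Since [n] squares to 0, [1 + n] is an automorphism; composing [phi] with it turns the corner
   [alpha] into the unit [alpha + beta \oc c \oc y]. *)
pose n : mor (dsum A B) (dsum A B) := inj2 A B \oc (c \oc y) \oc prj1 A B.
have nn : n \oc n = 0.
  by rewrite /n -!mcompA (mcompA (prj1 A B)) prj1_inj2 mcomp0m !mcompm0.
have nl : (idm _ - n) \oc (idm _ + n) = idm _.
  rewrite mcompDr mcompm1 (mcompDl (idm _)) mcomp1m mcompNm nn.
  by rewrite subr0 subrK.
have nr : (idm _ + n) \oc (idm _ - n) = idm _.
  rewrite mcompDr mcompm1 mcompmN (mcompDl (idm _)) mcomp1m nn.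
  by rewrite addr0 addrK.
apply: (@isomorphic_of_invertible_corner A B D
  (phi \oc (idm _ + n)) ((idm _ - n) \oc psi)).
- by rewrite -mcompA (mcompA psi) psiphi mcomp1m nl.
- by rewrite -mcompA (mcompA (idm _ + n)) nr mcomp1m.
suff -> : prj1 A D \oc (phi \oc (idm (dsum A B) + n)) \oc inj1 A B =
  alpha + beta \oc c \oc y by [].
rewrite mcompDr mcompm1 mcompDr mcompDl !mcompA; congr (_ + _).
by rewrite /n -!mcompA prj1_inj1 mcompm1 !mcompA.
Qed.

End Evans.

(** * Evaluation at a vertex, and the conclusion *)

Section Evaluation.
Variables (Q : quiver) (R : realization Q) (rho : Rep R) (v : vertex Q).

Definition rep_eval (f : endo rho) : endo (robj rho v) :=
  (f : rep_hom rho rho) v.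

Fact rep_eval_zmod : zmod_morphism rep_eval.
Proof. by []. Qed.

HB.instance Definition _ :=
  GRing.isZmodMorphism.Build _ _ rep_eval rep_eval_zmod.

Fact rep_eval_monoid : monoid_morphism rep_eval.
Proof. by []. Qed.

HB.instance Definition _ :=
  GRing.isMonoidMorphism.Build _ _ rep_eval rep_eval_monoid.
End Evaluation.

Lemma invertible_rep_eval (Q : quiver) (R : realization Q) (rho : Rep R)
    (u : endo rho) : (forall v, invertible (rep_eval v u)) -> invertible u.
Proof.
move=> inv; pose u' : rep_hom rho rho := u.
pose w v := sval (cid (inv v));
have uw v : w v * rep_eval v u = 1 /\ rep_eval v u * w v = 1.
  exact: svalP (cid (inv v)).
have wE a : fmap (tfun R a) (w (target a)) \oc rarr rho a
          = rarr rho a \oc fmap (sfun R a) (w (source a)).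
  have [wu _] := uw (target a); have [_ us] := uw (source a).
  (* Insert [u \oc w] at the source, carry [u] across the arrow, and cancel [w \oc u] at the
     target. *)
  rewrite -[LHS]mcompm1 -fmap1 -[idm _]us fmapM -!mcompA.
  rewrite (mcompA (rarr rho a)) -[rarr rho a \oc _](rmorE u') !mcompA -fmapM.
  by rewrite [w _ \oc _]wu fmap1 mcomp1m.
exists (RepHom wE : endo rho).
by split; apply: rep_homP => v /=; case: (uw v).
Qed.

Theorem mainTheorem4 (Q : quiver) (R : realization Q) (rho : Rep R)
  (rho_semilocal : forall v : vertex Q, semilocal (endo (robj rho v))) :
  cancels rho.
Proof.
apply: cancels_of_stable_range1; apply: rank_acc_stable_range1.
pose f v := @to_mod_jac _ \o @rep_eval Q R rho v
  : {rmorphism endo rho -> mod_jac (endo (robj rho v))}.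
apply: (rank_acc_reflect (f := f)) => // u inv.
by apply: invertible_rep_eval => v; apply: invertible_mod_jac; apply: inv.
Qed.
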